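(* Let $P$ be a unification problem. If $P \Rightarrow^{+} P'$ (one or more transformation steps) with $P' = \langle \varnothing, \sigma_{P'}\rangle$ in solved form, then $\sigma_{P'}$ is a unifier of $P$.
   Context: Expressions: built from integer constants, string constants, the constant $\mathtt{empty}$, variables of the disjoint types $\mathtt{int},\mathtt{string},\mathtt{atom},\mathtt{list}$, and list concatenation $\mathtt{:}$. Types: $\mathtt{int},\mathtt{string} < \mathtt{atom} < \mathtt{list}$, with $\mathtt{int}$ and $\mathtt{string}$ incomparable. After normalisation, each expression has a smallest type: integer constants/variables have type $\mathtt{int}$, string constants/variables type $\mathtt{string}$, atom variables type $\mathtt{atom}$, and $\mathtt{empty}$, list variables and concatenations of at least two items type $\mathtt{list}$. A simple expression uses no operator other than $\mathtt{:}$ and contains at most one occurrence of a list variable. Normalisation: apply $L\mathtt{:}\mathtt{empty} \to L$, $\mathtt{empty}\mathtt{:}L \to L$ exhaustively. A substitution maps variables to expressions of their type; $t\theta$ is simultaneous replacement; $\sigma\circ\theta$ is defined by $x(\sigma\circ\theta) = (x\sigma)\theta$ if $x \in \mathrm{Dom}(\sigma)=\{x \mid x\sigma\neq x\}$ and $x\theta$ otherwise. $=_{\mathrm{AU}}$ is the congruence generated by $x\mathtt{:}(y\mathtt{:}z) = (x\mathtt{:}y)\mathtt{:}z$, $\mathtt{empty}\mathtt{:}x = x$, $x\mathtt{:}\mathtt{empty} = x$. A unification problem is either $\langle s = t, \sigma_P\rangle$ with $s,t$ simple list expressions without common variables, or a solved problem $\langle \varnothing, \sigma_P\rangle$, or $\mathtt{fail}$.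 A unifier of $\langle s=t,\sigma_P\rangle$ is a substitution $\theta$ with $s\theta =_{\mathrm{AU}} t\theta$ and $x_i\theta =_{\mathrm{AU}} t_i\theta$ for every binding $x_i\mapsto t_i$ of $\sigma_P$; a unifier of $\langle\varnothing,\sigma_P\rangle$ only needs the latter condition (so $\sigma_P$ unifies $\langle\varnothing,\sigma_P\rangle$ by definition). Transformation relation $\Rightarrow$: in the rules below, $L,M$ range over simple expressions (possibly $\mathtt{empty}$), $\mathtt{x},\mathtt{y}$ over variables of any type, $\mathtt{a},\mathtt{b}$ over integer/string constants or variables of type $\mathtt{int},\mathtt{string},\mathtt{atom}$, and $\mathtt{s}$ over integer/string constants or variables of any type. A rule applies to $P$ if its premise, after instantiation and normalisation, is identical to $P$ and its side conditions hold; the result is the normalised conclusion. Fresh variables are new list variables. Remove: $\langle L=L,\sigma\rangle \Rightarrow \langle\varnothing,\sigma\rangle$. Decomp1: $\langle \mathtt{x}\mathtt{:}L = \mathtt{s}\mathtt{:}M,\sigma\rangle \Rightarrow \langle L=M, \sigma\circ\{\mathtt{x}\mapsto\mathtt{s}\}\rangle$ if $L\neq\mathtt{empty}$, $\mathrm{type}(\mathtt{x})=\mathtt{list}$. Decomp1': $\langle \mathtt{x}\mathtt{:}L = \mathtt{a}\mathtt{:}M,\sigma\rangle \Rightarrow \langle (L=M)\{\mathtt{x}\mapsto\mathtt{a}\}, \sigma\circ\{\mathtt{x}\mapsto\mathtt{a}\}\rangle$ if $L\neq\mathtt{empty}$, $\mathrm{type}(\mathtt{a})\le\mathrm{type}(\mathtt{x})\le\mathtt{atom}$.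 Decomp2: $\langle \mathtt{x}\mathtt{:}L = \mathtt{y}\mathtt{:}M,\sigma\rangle \Rightarrow \langle \mathtt{x'}\mathtt{:}L = M, \sigma\circ\{\mathtt{x}\mapsto\mathtt{y}\mathtt{:}\mathtt{x'}\}\rangle$ if $L\neq\mathtt{empty}$, $\mathtt{x},\mathtt{y}$ of type $\mathtt{list}$, $\mathtt{x'}$ fresh. Decomp2': $\langle \mathtt{x}\mathtt{:}L = \mathtt{y}\mathtt{:}M,\sigma\rangle \Rightarrow \langle L = \mathtt{y'}\mathtt{:}M, \sigma\circ\{\mathtt{y}\mapsto\mathtt{x}\mathtt{:}\mathtt{y'}\}\rangle$ if $L\neq\mathtt{empty}$, $\mathtt{x},\mathtt{y}$ of type $\mathtt{list}$, $\mathtt{y'}$ fresh. Decomp3: $\langle \mathtt{s}\mathtt{:}L = \mathtt{s}\mathtt{:}M,\sigma\rangle \Rightarrow \langle L=M,\sigma\rangle$. Decomp4: $\langle \mathtt{x} = \mathtt{a}\mathtt{:}\mathtt{y},\sigma\rangle \Rightarrow \langle \mathtt{empty}=\mathtt{y}, \sigma\circ\{\mathtt{x}\mapsto\mathtt{a}\}\rangle$ if $\mathrm{type}(\mathtt{x})=\mathtt{atom}$, $\mathrm{type}(\mathtt{y})=\mathtt{list}$. Subst1: $\langle \mathtt{x} = L,\sigma\rangle \Rightarrow \langle\varnothing, \sigma\circ\{\mathtt{x}\mapsto L\}\rangle$ if $\mathtt{x}\notin\mathrm{Var}(L)$, $\mathrm{type}(\mathtt{x})\ge\mathrm{type}(L)$.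 Subst2: $\langle \mathtt{x}\mathtt{:}L = M,\sigma\rangle \Rightarrow \langle L=M, \sigma\circ\{\mathtt{x}\mapsto\mathtt{empty}\}\rangle$ if $L\neq\mathtt{empty}$, $\mathrm{type}(\mathtt{x})=\mathtt{list}$. Subst3: $\langle \mathtt{x}\mathtt{:}L = \mathtt{a}\mathtt{:}M,\sigma\rangle \Rightarrow \langle \mathtt{x'}\mathtt{:}L=M, \sigma\circ\{\mathtt{x}\mapsto\mathtt{a}\mathtt{:}\mathtt{x'}\}\rangle$ if $L\neq\mathtt{empty}$, $\mathtt{x'}$ fresh, $\mathrm{type}(\mathtt{x})=\mathtt{list}$. Orient1: $\langle \mathtt{a}\mathtt{:}M = \mathtt{x}\mathtt{:}L,\sigma\rangle \Rightarrow \langle \mathtt{x}\mathtt{:}L = \mathtt{a}\mathtt{:}M,\sigma\rangle$ if $\mathtt{a}$ is not a variable. Orient2: $\langle \mathtt{x}\mathtt{:}L = \mathtt{y},\sigma\rangle \Rightarrow \langle \mathtt{y} = \mathtt{x}\mathtt{:}L,\sigma\rangle$ if $L\neq\mathtt{empty}$, $\mathrm{type}(\mathtt{x})=\mathrm{type}(\mathtt{y})$. Orient3: $\langle \mathtt{y}\mathtt{:}M = \mathtt{x}\mathtt{:}L,\sigma\rangle \Rightarrow \langle \mathtt{x}\mathtt{:}L = \mathtt{y}\mathtt{:}M,\sigma\rangle$ if $\mathrm{type}(\mathtt{y})<\mathrm{type}(\mathtt{x})$. Orient4: $\langle \mathtt{empty} = \mathtt{x}\mathtt{:}L,\sigma\rangle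 \Rightarrow \langle \mathtt{x}\mathtt{:}L = \mathtt{empty},\sigma\rangle$ if $\mathrm{type}(\mathtt{x})=\mathtt{list}$.
   Formalization: The formal theorem adds that the starting substitution σ_P unifies ⟨∅,σ_P⟩ and that variables bound by σ_P do not occur in s or t; otherwise ⟨x=a,{x↦b}⟩ ⇒ ⟨∅,{x↦b}⟩ by Subst1 is a counterexample. *)

(* Defs.v *)
From Stdlib Require Import ZArith String Relations.

Inductive ty : Set := Tint | Tstring | Tatom | Tlist.

Definition ty_le (t u : ty) : Prop :=
  match t, u with
  | _, Tlist => True
  | Tlist, _ => False
  | _, Tatom => True
  | Tint, Tint => True
  | Tstring, Tstring => True
  | _, _ => False
  end.

Definition ty_lt (t u : ty) : Prop := ty_le t u /\ t <> u.

(* The variables of each type are indexed by [nat]; tagging the index with the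
   type makes the four classes disjoint. *)
Record var : Set := Var { vty : ty; vname : nat }.

Inductive expr : Set :=
  | EInt (z : Z)
  | EStr (w : string)
  | EEmpty
  | EVar (x : var)
  | ECat (e1 e2 : expr).

(* Right associative, so that [x ::: L] has the head [x] and the tail [L]. *)
Notation "e1 ::: e2" := (ECat e1 e2) (at level 60, right associativity).

Definition var_eq_dec (x y : var) : {x = y} + {x <> y}.
Proof. repeat decide equality. Defined.

Definition expr_eq_dec (e f : expr) : {e = f} + {e <> f}.
Proof.
  decide equality;
    [apply Z.eq_dec | apply string_dec | apply var_eq_dec].
Defined.

(* The normal form for [L : empty -> L] and [empty : L -> L]. *)
Fixpoint nf (e : expr) : expr :=
  match e with
  | e1 ::: e2 =>
      match nf e1, nf e2 with
      | EEmpty, f2 => f2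
      | f1, EEmpty => f1
      | f1, f2 => f1 ::: f2
      end
  | _ => e
  end.

(* The smallest type of an expression is read off its normal form. *)
Definition type_of (e : expr) : ty :=
  match nf e with
  | EInt _ => Tint
  | EStr _ => Tstring
  | EVar x => vty x
  | EEmpty => Tlist
  | _ ::: _ => Tlist
  end.

Fixpoint occurs (x : var) (e : expr) : Prop :=
  match e with
  | EVar y => x = y
  | e1 ::: e2 => occurs x e1 \/ occurs x e2
  | _ => False
  end.

Fixpoint list_var_occurrences (e : expr) : nat :=
  match e with
  | EVar x => match vty x with Tlist => 1 | _ => 0 end
  | e1 ::: e2 => list_var_occurrences e1 + list_var_occurrences e2
  | _ => 0
  end.

(* [expr] has no operator other than concatenation, so simplicity only
   restricts the list variables. *)
Definition simple (e : expr) : Prop := list_var_occurrences e <= 1.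

Inductive AU : expr -> expr -> Prop :=
  | AU_assoc e1 e2 e3 : AU (e1 ::: (e2 ::: e3)) ((e1 ::: e2) ::: e3)
  | AU_unitl e : AU (EEmpty ::: e) e
  | AU_unitr e : AU (e ::: EEmpty) e
  | AU_refl e : AU e e
  | AU_sym e f : AU e f -> AU f e
  | AU_trans e f g : AU e f -> AU f g -> AU e g
  | AU_cat e1 e2 f1 f2 : AU e1 f1 -> AU e2 f2 -> AU (e1 ::: e2) (f1 ::: f2).

(* Candidate substitutions; the typing requirement is [is_subst]. *)
Definition subst : Set := var -> expr.

Definition is_subst (sigma : subst) : Prop :=
  forall x, ty_le (type_of (sigma x)) (vty x).

Definition in_dom (sigma : subst) (x : var) : Prop := sigma x <> EVar x.

Fixpoint apply (sigma : subst) (e : expr) : expr :=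
  match e with
  | EVar x => sigma x
  | e1 ::: e2 => apply sigma e1 ::: apply sigma e2
  | _ => e
  end.

(* Diagrammatic order: [sigma] is applied first. *)
Definition compose (sigma theta : subst) : subst := fun x =>
  if expr_eq_dec (sigma x) (EVar x) then theta x else apply theta (sigma x).

Definition single (x : var) (e : expr) : subst := fun y =>
  if var_eq_dec y x then e else EVar y.

Inductive problem : Set :=
  | Eqn (s t : expr) (sigma : subst)
  | Solved (sigma : subst)
  | Fail.

Definition unification_problem (P : problem) : Prop :=
  match P with
  | Eqn s t sigma =>
      simple s /\ simple t /\ (forall x, ~ (occurs x s /\ occurs x t)) /\
      is_subst sigma
  | Solved sigma => is_subst sigma
  | Fail => True
  end.

Definition satisfies_bindings (theta sigma : subst) : Prop :=
  forall x, in_dom sigma x -> AU (theta x) (apply theta (sigma x)).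

Definition unifier (theta : subst) (P : problem) : Prop :=
  is_subst theta /\
  match P with
  | Eqn s t sigma =>
      AU (apply theta s) (apply theta t) /\ satisfies_bindings theta sigma
  | Solved sigma => satisfies_bindings theta sigma
  | Fail => False
  end.

(* The bindings already computed are a solved form: they unify themselves, and
   the variables they bind have been eliminated from the equation. Both parts
   are needed for soundness. With a list variable [x] and a constant [a], take
   [<empty = empty, {x |-> a : x}>] for the first, and [<x = a, {x |-> b}>]
   with a constant [b] other than [a] for the second. *)
Definition solved_bindings (P : problem) : Prop :=
  match P with
  | Eqn s t sigma =>
      unifier sigma (Solved sigma) /\
      (forall x, in_dom sigma x -> ~ occurs x s /\ ~ occurs x t)
  | Solved sigma => unifier sigma (Solved sigma)
  | Fail => True
  end.

Definition normalise (P : problem) : problem :=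
  match P with
  | Eqn s t sigma => Eqn (nf s) (nf t) (fun x => nf (sigma x))
  | Solved sigma => Solved (fun x => nf (sigma x))
  | Fail => Fail
  end.

Definition is_const (e : expr) : Prop :=
  match e with EInt _ | EStr _ => True | _ => False end.

(* The metavariables [a] and [b] of the rules range over these. *)
Definition is_atomic (e : expr) : Prop :=
  is_const e \/ exists x, e = EVar x /\ ty_le (vty x) Tatom.

(* The metavariable [s] of the rules ranges over these. *)
Definition is_symbol (e : expr) : Prop :=
  is_const e \/ exists x, e = EVar x.

Definition fresh (x : var) (s t : expr) (sigma : subst) : Prop :=
  vty x = Tlist /\ ~ occurs x s /\ ~ occurs x t /\ ~ in_dom sigma x /\
  (forall y, in_dom sigma y -> ~ occurs x (sigma y)).

(* An instance of a rule: premise and conclusion before normalisation. The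
   condition [L <> empty] is about the normal form of [L], since the instance
   of [L] need not be normalised. *)
Inductive rule : problem -> problem -> Prop :=
  | Remove L sigma :
      simple L ->
      rule (Eqn L L sigma) (Solved sigma)
  | Decomp1 x L s M sigma :
      simple L -> simple M -> is_symbol s ->
      nf L <> EEmpty -> vty x = Tlist ->
      rule (Eqn (EVar x ::: L) (s ::: M) sigma)
           (Eqn L M (compose sigma (single x s)))
  | Decomp1' x L a M sigma :
      simple L -> simple M -> is_atomic a ->
      nf L <> EEmpty ->
      ty_le (type_of a) (vty x) -> ty_le (vty x) Tatom ->
      rule (Eqn (EVar x ::: L) (a ::: M) sigma)
           (Eqn (apply (single x a) L) (apply (single x a) M)
                (compose sigma (single x a)))
  | Decomp2 x L y M x' sigma :
      simple L -> simple M ->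
      nf L <> EEmpty -> vty x = Tlist -> vty y = Tlist ->
      fresh x' (EVar x ::: L) (EVar y ::: M) sigma ->
      rule (Eqn (EVar x ::: L) (EVar y ::: M) sigma)
           (Eqn (EVar x' ::: L) M
                (compose sigma (single x (EVar y ::: EVar x'))))
  | Decomp2' x L y M y' sigma :
      simple L -> simple M ->
      nf L <> EEmpty -> vty x = Tlist -> vty y = Tlist ->
      fresh y' (EVar x ::: L) (EVar y ::: M) sigma ->
      rule (Eqn (EVar x ::: L) (EVar y ::: M) sigma)
           (Eqn L (EVar y' ::: M)
                (compose sigma (single y (EVar x ::: EVar y'))))
  | Decomp3 s L M sigma :
      simple L -> simple M -> is_symbol s ->
      rule (Eqn (s ::: L) (s ::: M) sigma) (Eqn L M sigma)
  | Decomp4 x a y sigma :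
      is_atomic a -> vty x = Tatom -> vty y = Tlist ->
      rule (Eqn (EVar x) (a ::: EVar y) sigma)
           (Eqn EEmpty (EVar y) (compose sigma (single x a)))
  | Subst1 x L sigma :
      simple L -> ~ occurs x L -> ty_le (type_of L) (vty x) ->
      rule (Eqn (EVar x) L sigma) (Solved (compose sigma (single x L)))
  | Subst2 x L M sigma :
      simple L -> simple M ->
      nf L <> EEmpty -> vty x = Tlist ->
      rule (Eqn (EVar x ::: L) M sigma)
           (Eqn L M (compose sigma (single x EEmpty)))
  | Subst3 x L a M x' sigma :
      simple L -> simple M -> is_atomic a ->
      nf L <> EEmpty -> fresh x' (EVar x ::: L) (a ::: M) sigma ->
      vty x = Tlist ->
      rule (Eqn (EVar x ::: L) (a ::: M) sigma)
           (Eqn (EVar x' ::: L) M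
                (compose sigma (single x (a ::: EVar x'))))
  | Orient1 a M x L sigma :
      simple L -> simple M -> is_const a ->
      rule (Eqn (a ::: M) (EVar x ::: L) sigma)
           (Eqn (EVar x ::: L) (a ::: M) sigma)
  | Orient2 x L y sigma :
      simple L ->
      nf L <> EEmpty -> vty x = vty y ->
      rule (Eqn (EVar x ::: L) (EVar y) sigma)
           (Eqn (EVar y) (EVar x ::: L) sigma)
  | Orient3 y M x L sigma :
      simple L -> simple M -> ty_lt (vty y) (vty x) ->
      rule (Eqn (EVar y ::: M) (EVar x ::: L) sigma)
           (Eqn (EVar x ::: L) (EVar y ::: M) sigma)
  | Orient4 x L sigma :
      simple L -> vty x = Tlist ->
      rule (Eqn EEmpty (EVar x ::: L) sigma)
           (Eqn (EVar x ::: L) EEmpty sigma).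

Definition step (P P' : problem) : Prop :=
  exists A B, rule A B /\ P = normalise A /\ P' = normalise B.

Definition steps : problem -> problem -> Prop := clos_trans problem step.

(* Main.v *)
(** Soundness of a step is proved backwards: a rule that binds [v] to [t] extends
    the bindings to [sigma] followed by [{v |-> t}], and a unifier [theta] of
    these satisfies [v theta = t theta], because [sigma] fixes [v]; the equation
    before the step then follows from the one after it.  It remains that the last
    bindings unify themselves.  For that one needs an invariant: the variables of
    the equation are fixed by the bindings, the bindings are idempotent, and both
    sides are simple without a common list variable (common variables of other
    types arise from Decomp1').  Everything is stated up to [AU], so that
    normalisation does not matter. *)

From Stdlib Require Import Lia Setoid Morphisms.
Require Import Defs.
From Stdlib Require Import ZArith String Relations.

(** * Normal forms and rewriting modulo [AU] *)

#[global] Instance AU_Equivalence : Equivalence AU.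
Proof.
  split; [exact AU_refl | exact AU_sym | exact AU_trans].
Qed.

#[global] Instance ECat_AU_Proper : Proper (AU ==> AU ==> AU) ECat.
Proof. intros e1 f1 H1 e2 f2 H2; now apply AU_cat. Qed.

#[global] Instance apply_AU_Proper theta : Proper (AU ==> AU) (apply theta).
Proof.
  intros e f H; induction H; simpl;
    eauto using AU_assoc, AU_unitl, AU_unitr, AU_refl, AU_sym, AU_trans, AU_cat.
Qed.

Lemma nf_AU e : AU (nf e) e.
Proof.
  induction e; simpl; try reflexivity.
  transitivity (nf e1 ::: nf e2); [|now apply AU_cat].
  destruct (nf e1), (nf e2); try reflexivity;
    first [apply AU_sym, AU_unitl | apply AU_sym, AU_unitr].
Qed.

(** Instantiation can create new occurrences of [EEmpty], so the two sides agree only after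
    normalising again. *)
Lemma nf_apply_nf theta e : nf (apply theta (nf e)) = nf (apply theta e).
Proof.
  induction e; simpl; try reflexivity.
  rewrite <- IHe1, <- IHe2.
  destruct (nf e1), (nf e2); cbn [apply]; try reflexivity;
    (* Here the second factor is [EEmpty], and each branch of the match on the first normal form
       returns that normal form. *)
    match goal with |- ?f = _ => now destruct f end.
Qed.

Lemma apply_EVar e : apply EVar e = e.
Proof. induction e; simpl; congruence. Qed.

Lemma nf_idem e : nf (nf e) = nf e.
Proof. generalize (nf_apply_nf EVar e); now rewrite !apply_EVar. Qed.

Lemma type_of_nf e : type_of (nf e) = type_of e.
Proof. unfold type_of; now rewrite nf_idem. Qed.

Lemma occurs_nf x e : occurs x (nf e) <-> occurs x e.
Proof.
  induction e; simpl; try tauto.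
  rewrite <- IHe1, <- IHe2.
  destruct (nf e1), (nf e2); simpl; tauto.
Qed.

Lemma list_var_occurrences_nf e :
  list_var_occurrences (nf e) = list_var_occurrences e.
Proof.
  induction e; simpl; try reflexivity.
  rewrite <- IHe1, <- IHe2.
  destruct (nf e1), (nf e2); simpl; lia.
Qed.

Lemma simple_nf e : simple (nf e) <-> simple e.
Proof. unfold simple; now rewrite list_var_occurrences_nf. Qed.

(** * Typing, substitution and composition *)

Lemma ty_le_Tlist t : ty_le t Tlist.
Proof. now destruct t. Qed.

Lemma ty_le_refl t : ty_le t t.
Proof. now destruct t. Qed.

Lemma ty_le_trans t u v : ty_le t u -> ty_le u v -> ty_le t v.
Proof. now destruct t, u, v. Qed.

(** A type below [Tlist] forces the normal form to be a single constant or variable; constants are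
    unchanged, and [is_subst] bounds the image of a variable. *)
Lemma type_of_apply theta e :
  is_subst theta -> ty_le (type_of (apply theta e)) (type_of e).
Proof.
  intros H; unfold type_of at 1; rewrite <- nf_apply_nf; fold (type_of (apply theta (nf e))).
  unfold type_of at 2; destruct (nf e); try apply ty_le_refl; try apply ty_le_Tlist.
  apply H.
Qed.

Lemma apply_AU_ext theta rho e :
  (forall x, occurs x e -> AU (theta x) (rho x)) -> AU (apply theta e) (apply rho e).
Proof.
  induction e; simpl; intros H; try reflexivity; auto using AU_cat.
Qed.

Lemma apply_fixed theta e :
  (forall x, occurs x e -> AU (theta x) (EVar x)) -> AU (apply theta e) e.
Proof.
  intros H; rewrite <- (apply_EVar e) at 2; now apply apply_AU_ext.
Qed.

Lemma apply_apply theta rho e :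
  apply theta (apply rho e) = apply (fun x => apply theta (rho x)) e.
Proof. induction e; simpl; congruence. Qed.

(** Outside the domain of [sigma] both branches of [compose] give [theta x], so the case distinction
    disappears. *)
Lemma composeE sigma theta x : compose sigma theta x = apply theta (sigma x).
Proof.
  unfold compose; destruct (expr_eq_dec (sigma x) (EVar x)) as [E|]; trivial.
  now rewrite E.
Qed.

Lemma single_eq x e : single x e x = e.
Proof. unfold single; now destruct (var_eq_dec x x). Qed.

Lemma single_neq x e y : y <> x -> single x e y = EVar y.
Proof. unfold single; now destruct (var_eq_dec y x). Qed.

Lemma is_subst_single x e : ty_le (type_of e) (vty x) -> is_subst (single x e).
Proof.
  intros H y; unfold single; destruct (var_eq_dec y x); subst; trivial.
  apply ty_le_refl.
Qed.

Lemma is_subst_compose sigma theta :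
  is_subst sigma -> is_subst theta -> is_subst (compose sigma theta).
Proof.
  intros Hs Ht x; rewrite composeE.
  eapply ty_le_trans; [now apply type_of_apply | apply Hs].
Qed.

Lemma is_subst_nf sigma : is_subst (fun x => nf (sigma x)) <-> is_subst sigma.
Proof.
  unfold is_subst; split; intros H x; specialize (H x); now rewrite type_of_nf in *.
Qed.

(** * Bindings as equations modulo [AU] *)

(** Outside the domain the equation is reflexivity. Dropping the syntactic test [in_dom] makes the
    condition stable under [AU], hence under normalisation. *)
Lemma satisfies_bindingsE theta sigma :
  satisfies_bindings theta sigma <-> (forall x, AU (theta x) (apply theta (sigma x))).
Proof.
  split; intros H x; auto.
  destruct (expr_eq_dec (sigma x) (EVar x)) as [E|E]; auto.
  rewrite E; reflexivity.
Qed.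

Lemma satisfies_bindings_nf theta sigma :
  satisfies_bindings theta (fun x => nf (sigma x)) <-> satisfies_bindings theta sigma.
Proof.
  rewrite !satisfies_bindingsE.
  split; intros H x; specialize (H x); now rewrite nf_AU in *.
Qed.

Lemma unifier_normalise theta P : unifier theta (normalise P) <-> unifier theta P.
Proof.
  destruct P; simpl; unfold unifier; simpl; rewrite ?satisfies_bindings_nf, ?nf_AU; tauto.
Qed.

(** Evaluating the composed bindings at [v], which [sigma] fixes, yields the first conclusion. Then
    [theta] absorbs [{v |-> t}], which leaves the bindings of [sigma]. *)
Lemma satisfies_bindings_compose_single theta sigma v t :
  AU (sigma v) (EVar v) ->
  satisfies_bindings theta (compose sigma (single v t)) ->
  AU (theta v) (apply theta t) /\ satisfies_bindings theta sigma.
Proof.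
  rewrite !satisfies_bindingsE; intros Hv H.
  assert (Ht : AU (theta v) (apply theta t)).
  { specialize (H v); rewrite composeE, Hv in H; simpl in H.
    now rewrite single_eq in H. }
  split; trivial; intros x.
  rewrite (H x), composeE, apply_apply.
  apply apply_AU_ext; intros y _.
  destruct (var_eq_dec y v) as [->|N].
  - rewrite single_eq; now symmetry.
  - now rewrite single_neq.
Qed.

Lemma apply_single_unified theta v t e :
  AU (theta v) (apply theta t) ->
  AU (apply theta (apply (single v t) e)) (apply theta e).
Proof.
  intros Ht; rewrite apply_apply; apply apply_AU_ext; intros y _.
  destruct (var_eq_dec y v) as [->|N].
  - rewrite single_eq; now symmetry.
  - now rewrite single_neq.
Qed.

Lemma single_EVar_same v x : single v (EVar v) x = EVar x.
Proof. unfold single; destruct (var_eq_dec x v); congruence. Qed.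

(** The composite [rho] fixes [t], so it absorbs [{v |-> t}], and its idempotence reduces to that of
    [sigma]. The case [t = EVar v] arises when a non-list variable meets itself. *)
Lemma satisfies_bindings_self_compose sigma v t :
  satisfies_bindings sigma sigma ->
  AU (sigma v) (EVar v) ->
  (forall z, occurs z t -> AU (sigma z) (EVar z)) ->
  t = EVar v \/ ~ occurs v t ->
  satisfies_bindings (compose sigma (single v t)) (compose sigma (single v t)).
Proof.
  rewrite !satisfies_bindingsE; intros Hs Hv Ht Hvt x.
  set (rho := compose sigma (single v t)).
  assert (E : forall z, rho z = apply (single v t) (sigma z)) by (intros; apply composeE).
  assert (Hrv : AU (rho v) t) by (rewrite E, Hv; simpl; now rewrite single_eq).
  assert (Hrt : AU (apply rho t) t).
  { destruct Hvt as [->|N]; [exact Hrv|].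
    apply apply_fixed; intros z Hz.
    rewrite E, (Ht z Hz); simpl; rewrite single_neq; [reflexivity | congruence]. }
  (* Only the inner [rho x] is unfolded: the outer [rho] has to absorb the single binding. *)
  rewrite (E x) at 2.
  rewrite apply_single_unified by (now rewrite Hrv, Hrt).
  transitivity (apply (single v t) (apply sigma (sigma x))).
  - rewrite E; now rewrite <- Hs.
  - rewrite apply_apply; apply apply_AU_ext; intros z _; now rewrite E.
Qed.

(** * The invariant and its stability under normalisation *)

(* Stated with [AU] instead of [in_dom], which a step of normalisation such as
   [empty : x] to [x] changes. *)
Definition eliminated (s t : expr) (sigma : subst) : Prop :=
  forall z, occurs z s \/ occurs z t -> AU (sigma z) (EVar z).

Definition list_disjoint (s t : expr) : Prop :=
  forall z, vty z = Tlist -> occurs z s -> occurs z t -> False.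

(** The condition [satisfies_bindings sigma sigma] is idempotence of [sigma] modulo [AU]. *)
Definition invariant (P : problem) : Prop :=
  match P with
  | Eqn s t sigma =>
      (simple s /\ simple t /\ list_disjoint s t) /\ eliminated s t sigma /\
      is_subst sigma /\ satisfies_bindings sigma sigma
  | Solved sigma => is_subst sigma /\ satisfies_bindings sigma sigma
  | Fail => True
  end.

Lemma satisfies_bindings_self_nf sigma :
  satisfies_bindings (fun x => nf (sigma x)) (fun x => nf (sigma x)) <->
  satisfies_bindings sigma sigma.
Proof.
  rewrite satisfies_bindings_nf, !satisfies_bindingsE.
  assert (E : forall x, AU (apply (fun x => nf (sigma x)) (sigma x)) (apply sigma (sigma x)))
    by (intros x; apply apply_AU_ext; intros; apply nf_AU).
  split; intros H x; specialize (H x); now rewrite nf_AU, E in *.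
Qed.

Lemma invariant_normalise P : invariant (normalise P) <-> invariant P.
Proof.
  destruct P as [s t sigma|sigma|]; simpl;
    rewrite ?is_subst_nf, ?satisfies_bindings_self_nf, ?simple_nf; try tauto.
  assert (Ed : list_disjoint (nf s) (nf t) <-> list_disjoint s t)
    by (unfold list_disjoint; split; intros H z; specialize (H z);
        now rewrite !occurs_nf in *).
  assert (Ee : eliminated (nf s) (nf t) (fun x => nf (sigma x)) <-> eliminated s t sigma)
    by (unfold eliminated; split; intros H z; specialize (H z);
        now rewrite !occurs_nf, nf_AU in *).
  tauto.
Qed.

(** * Occurrences of variables in simple expressions *)

Lemma list_var_occurrences_pos z e :
  vty z = Tlist -> occurs z e -> 1 <= list_var_occurrences e.
Proof.
  intros Hz; induction e; simpl; try tauto.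
  - intros <-; now rewrite Hz.
  - intros [H|H]; [apply IHe1 in H | apply IHe2 in H]; lia.
Qed.

(** The head uses up the one list variable that simplicity allows. This is why binding a list
    variable [x] eliminates it without substituting in the tail. *)
Lemma simple_cons_list_not_occurs x L z :
  vty x = Tlist -> simple (EVar x ::: L) -> vty z = Tlist -> ~ occurs z L.
Proof.
  unfold simple; simpl; intros -> H Hz HL.
  apply list_var_occurrences_pos in HL; trivial; lia.
Qed.

Lemma simple_cons_rename x x' L :
  vty x = Tlist -> simple (EVar x ::: L) -> simple (EVar x' ::: L).
Proof.
  unfold simple; simpl; intros ->; destruct (vty x'); lia.
Qed.

Lemma is_atomic_symbol a : is_atomic a -> is_symbol a.
Proof. unfold is_atomic, is_symbol; firstorder. Qed.

Lemma is_const_not_occurs a z : is_const a -> ~ occurs z a.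
Proof. now destruct a. Qed.

Lemma is_atomic_no_list a z : is_atomic a -> vty z = Tlist -> ~ occurs z a.
Proof.
  intros [H|(x & -> & H)] Hz; [now apply is_const_not_occurs|].
  simpl; intros ->; now rewrite Hz in H.
Qed.

Lemma is_symbol_occurs a z : is_symbol a -> a = EVar z \/ ~ occurs z a.
Proof.
  intros [H|(x & ->)]; [right; now apply is_const_not_occurs|].
  simpl; destruct (var_eq_dec z x); [left|right]; congruence.
Qed.

Lemma occurs_apply_single v t e z :
  occurs z (apply (single v t) e) -> occurs z e /\ z <> v \/ occurs z t.
Proof.
  induction e; simpl; try tauto.
  unfold single; destruct (var_eq_dec x v) as [->|N]; simpl; [tauto|].
  intros ->; now left.
Qed.

Lemma list_var_occurrences_apply_single v a e :
  ty_le (vty v) Tatom -> is_atomic a ->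
  list_var_occurrences (apply (single v a) e) = list_var_occurrences e.
Proof.
  intros Hv Ha; induction e; simpl; try congruence.
  unfold single; destruct (var_eq_dec x v) as [->|N]; [|reflexivity].
  assert (Hc : list_var_occurrences a = 0).
  { destruct Ha as [Ha|(y & -> & Hy)]; [now destruct a|].
    simpl; destruct (vty y); easy. }
  rewrite Hc; destruct (vty v); easy.
Qed.

(** * Preservation of the invariant *)

(** Shared by the rules that bind a variable and keep an equation. The alternative [e = EVar v]
    admits a trivial binding, after which [v] may still occur. *)
Lemma invariant_bind s t sigma s' t' v e :
  invariant (Eqn s t sigma) ->
  simple s' /\ simple t' /\ list_disjoint s' t' ->
  ty_le (type_of e) (vty v) ->
  AU (sigma v) (EVar v) ->
  (forall z, occurs z e -> AU (sigma z) (EVar z)) ->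
  e = EVar v \/ ~ occurs v e ->
  (forall z, occurs z s' \/ occurs z t' ->
     AU (sigma z) (EVar z) /\ (e = EVar v \/ z <> v)) ->
  invariant (Eqn s' t' (compose sigma (single v e))).
Proof.
  intros (_ & _ & Hs & Hb) Hd Hty Hv He Hve Hn; simpl.
  split; [|split; [|split]]; trivial.
  - intros z Hz; destruct (Hn z Hz) as [H1 H2].
    rewrite composeE, H1; simpl.
    destruct H2 as [->|N]; [rewrite single_EVar_same | rewrite single_neq by trivial];
      reflexivity.
  - now apply is_subst_compose, is_subst_single.
  - now apply satisfies_bindings_self_compose.
Qed.

Lemma not_in_dom_fixed sigma x : ~ in_dom sigma x -> AU (sigma x) (EVar x).
Proof.
  (* Decidable equality removes the double negation hidden in [~ in_dom sigma x]. *)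
  intros N; destruct (expr_eq_dec (sigma x) (EVar x)) as [->|D]; [reflexivity|].
  now elim N.
Qed.

Lemma rule_invariant A B : rule A B -> invariant A -> invariant B.
Proof.
  intros HR HA; destruct HR; pose proof HA as ((S1 & S2 & D) & E & Hs & Hb);
    unfold list_disjoint, eliminated in D, E; simpl in D, E.
  - split; trivial.
  - assert (Nx : ~ occurs x s) by (intros O; apply (D x); auto).
    assert (NM : ~ occurs x M) by (intros O; apply (D x); auto).
    assert (NL : ~ occurs x L) by now apply (simple_cons_list_not_occurs x L x).
    eapply invariant_bind; eauto.
    + repeat split; trivial; intros z; specialize (D z); tauto.
    + rewrite H3; apply ty_le_Tlist.
    + intros z Hz; split; [apply E; tauto | right; intros ->; tauto].
  (* Decomp1': neither simplicity nor [list_disjoint] restricts non-list variables, so [x] may recur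
     in [L] and [M] or be [a] itself. *)
  - eapply invariant_bind; eauto.
    + unfold simple, list_disjoint; rewrite !list_var_occurrences_apply_single by trivial.
      repeat split; trivial; intros z Hz O1 O2.
      apply occurs_apply_single in O1, O2.
      assert (Na : ~ occurs z a) by now apply is_atomic_no_list.
      apply (D z); tauto.
    + now apply is_symbol_occurs, is_atomic_symbol.
    + intros z Hz.
      assert (Hz' : (occurs z L \/ occurs z M) /\ z <> x \/ occurs z a)
        by (destruct Hz as [Hz|Hz]; apply occurs_apply_single in Hz; tauto).
      split; [apply E; tauto|].
      destruct (var_eq_dec z x) as [->|]; [|now right].
      destruct (is_symbol_occurs a x (is_atomic_symbol a H1)); tauto.
  - destruct H4 as (Tx' & F1 & F2 & F3 & _); simpl in F1, F2.
    assert (Ex' := not_in_dom_fixed sigma x' F3).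
    assert (NL : ~ occurs x L) by now apply (simple_cons_list_not_occurs x L x).
    assert (Ny : x <> y) by (intros O; apply (D x); auto).
    assert (NM : ~ occurs x M) by (intros O; apply (D x); auto).
    eapply invariant_bind; eauto.
    + repeat split; trivial; [now apply (simple_cons_rename x)|].
      (* The tail behind the list variable [y] has no list variable, so it is disjoint from any left
         side. *)
      intros z Tz _; now apply (simple_cons_list_not_occurs y M z).
    + rewrite H2; apply ty_le_Tlist.
    + simpl; intros z [-> | ->]; auto.
    + simpl; right; intros [O|O]; [now apply Ny | apply F1; now left].
    + simpl; intros z Hz; split.
      * destruct Hz as [[->|]|]; auto.
      * right; intros ->; destruct Hz as [[->|]|]; auto.
  - destruct H4 as (Ty' & F1 & F2 & F3 & _); simpl in F1, F2.
    assert (Ey' := not_in_dom_fixed sigma y' F3).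
    assert (NM : ~ occurs y M) by now apply (simple_cons_list_not_occurs y M y).
    assert (Nx : y <> x) by (intros O; apply (D y); auto).
    assert (NL : ~ occurs y L) by (intros O; apply (D y); auto).
    eapply invariant_bind; eauto.
    + repeat split; trivial; [now apply (simple_cons_rename y)|].
      intros z Tz O _; revert O; now apply (simple_cons_list_not_occurs x L z).
    + rewrite H3; apply ty_le_Tlist.
    + simpl; intros z [-> | ->]; auto.
    + simpl; right; intros [O|O]; [now apply Nx | apply F2; now left].
    + simpl; intros z Hz; split.
      * destruct Hz as [|[->|]]; auto.
      * right; intros ->; destruct Hz as [|[->|]]; auto.
  - repeat split; trivial.
    + intros z; specialize (D z); tauto.
    + intros z Hz; apply E; tauto.
  - eapply invariant_bind; eauto.
    + unfold simple, list_disjoint; simpl; rewrite H1; repeat split; trivial; lia.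
    + rewrite H0; destruct H as [H|(z & -> & H)]; [now destruct a | exact H].
    + now apply is_symbol_occurs, is_atomic_symbol.
    + simpl; intros z [[]| ->]; split; auto.
      (* Decomp4: [x] and [y] differ because their types do. *)
      right; intros ->; congruence.
  - split.
    + now apply is_subst_compose, is_subst_single.
    + apply satisfies_bindings_self_compose; auto.
  - assert (NM : ~ occurs x M) by (intros O; apply (D x); auto).
    assert (NL : ~ occurs x L) by now apply (simple_cons_list_not_occurs x L x).
    eapply invariant_bind; eauto.
    + repeat split; trivial; intros z; specialize (D z); tauto.
    + rewrite H2; apply ty_le_Tlist.
    + simpl; tauto.
    + intros z Hz; split; [apply E; tauto | right; intros ->; tauto].
  - destruct H3 as (Tx' & F1 & F2 & F3 & _); simpl in F1, F2.
    assert (Ex' := not_in_dom_fixed sigma x' F3).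
    assert (NL : forall z, vty z = Tlist -> ~ occurs z L)
      by (intros z Tz; now apply (simple_cons_list_not_occurs x L z)).
    assert (NM : ~ occurs x M) by (intros O; apply (D x); auto).
    assert (Na : ~ occurs x a) by now apply is_atomic_no_list.
    eapply invariant_bind; eauto.
    + repeat split; trivial; [now apply (simple_cons_rename x)|].
      intros z Tz [->|O] O'; [tauto | now apply (NL z)].
    + rewrite H4; apply ty_le_Tlist.
    + simpl; intros z [Hz | ->]; auto.
    + simpl; right; intros [O|O]; [now apply Na | apply F1; now left].
    + simpl; intros z Hz; split.
      * destruct Hz as [[->|]|]; auto.
      * right; intros ->; destruct Hz as [[->|Hz]|]; auto.
        now apply (NL x).
  (* The four orientation rules swap the sides, and the conditions on the equation are symmetric. *)
  - repeat split; trivial.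
    + intros z; specialize (D z); simpl; tauto.
    + intros z Hz; apply E; simpl in Hz; tauto.
  - repeat split; trivial.
    + intros z; specialize (D z); simpl; tauto.
    + intros z Hz; apply E; simpl in Hz; tauto.
  - repeat split; trivial.
    + intros z; specialize (D z); simpl; tauto.
    + intros z Hz; apply E; simpl in Hz; tauto.
  - repeat split; trivial.
    + intros z; specialize (D z); simpl; tauto.
    + intros z Hz; apply E; simpl in Hz; tauto.
Qed.

(** * Backward transfer of unifiers *)

Lemma rule_unifier A B theta :
  rule A B -> invariant A -> unifier theta B -> unifier theta A.
Proof.
  intros HR HA [Ht HB]; split; trivial.
  destruct HR; destruct HA as (_ & E & _); unfold eliminated in E; simpl in E;
    try destruct HB as [HQ HB];
    try (apply satisfies_bindings_compose_single in HB;
         [destruct HB as [Hv HB] | now auto]);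
    simpl in *; split; trivial;
    try (rewrite !apply_single_unified in HQ by trivial);
    try rewrite Hv; try (now rewrite HQ); try reflexivity; try (now symmetry).
  (* Left are Decomp2, Decomp2', Decomp4, Subst2 and Subst3, where the image of the bound variable
     must be reassociated or an [EEmpty] removed. *)
  - now rewrite <- AU_assoc, HQ.
  - now rewrite HQ, AU_assoc.
  - now rewrite <- HQ, AU_unitr.
  - now rewrite AU_unitl.
  - now rewrite <- AU_assoc, HQ.
Qed.

Lemma step_sound P P' :
  step P P' -> invariant P ->
  invariant P' /\ (forall theta, unifier theta P' -> unifier theta P).
Proof.
  intros (A & B & HR & -> & ->); rewrite !invariant_normalise; intros HA.
  split; [now apply (rule_invariant A B)|].
  intros theta; rewrite !unifier_normalise; now apply rule_unifier.
Qed.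

Lemma steps_sound P P' :
  steps P P' -> invariant P ->
  invariant P' /\ (forall theta, unifier theta P' -> unifier theta P).
Proof.
  induction 1 as [P P' H|P Q R _ IH1 _ IH2]; [now apply step_sound|].
  intros HP; destruct (IH1 HP) as [HQ U1]; destruct (IH2 HQ) as [HR U2]; auto.
Qed.

Lemma solved_bindings_invariant P :
  unification_problem P -> solved_bindings P -> invariant P.
Proof.
  destruct P as [s t sigma|sigma|]; simpl; trivial.
  intros (S1 & S2 & D & Hs) ((_ & Hb) & HE); repeat split; trivial.
  - intros z _ O1 O2; now apply (D z).
  - intros z Hz; apply not_in_dom_fixed; intros N; destruct (HE z N); tauto.
Qed.

Theorem theorem2 (P : problem) (sigma' : subst)
  (hP : unification_problem P)
  (hsolved : solved_bindings P)
  (hsteps : steps P (Solved sigma')) :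
  unifier sigma' P.
Proof.
  destruct (steps_sound _ _ hsteps (solved_bindings_invariant P hP hsolved)) as [HI HU].
  (* For a solved problem the invariant [HI] says exactly that [sigma'] unifies it. *)
  now apply HU.
Qed.
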